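(* Let $N\ge 2$. For generic $\theta\in\mathbb{T}^N$ (that is, for all $\theta$ in some open dense subset of $\mathbb{T}^N$) and for every directed graph $\mathbf{H}$ on the vertex set $\{1,\dots,N\}$ without self-loops, there exists a coupling function $\mathrm{g}$ such that $\mathcal{G}_{\mathrm{g}}(\theta)=\mathbf{H}$.
   Context: $\mathbb{T}=\mathbb{R}/2\pi\mathbb{Z}$. A coupling function is a non-constant smooth function $\mathrm{g}:\mathbb{T}\to\mathbb{R}$. Let $\mathrm{LC}(\mathrm{g})$ be the set of points of $\mathbb{T}$ having an open neighbourhood on which $\mathrm{g}$ is constant, and $\mathrm{DZ}(\mathrm{g})$ the set of points having an open neighbourhood on which $\mathrm{g}\equiv 0$. All coupling functions are assumed to have simple dead zones: $\mathrm{DZ}(\mathrm{g})$ has finitely many connected components and $\mathrm{LC}(\mathrm{g})=\mathrm{DZ}(\mathrm{g})$. The effective coupling graph $\mathcal{G}_{\mathrm{g}}(\theta)$ at $\theta\in\mathbb{T}^N$ (for the all-to-all coupled network $\dot\theta_k=\omega+\sum_{j\ne k}\mathrm{g}(\theta_j-\theta_k)$) is the directed graph on $\{1,\dots,N\}$ with edge set $\{(j,k): j\neq k,\ \theta_j-\theta_k\notin\mathrm{DZ}(\mathrm{g})\}$. *)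

(* Defs.v *)
From HB Require Import structures.
From mathcomp Require Import all_boot all_order all_algebra.
From mathcomp Require Import all_classical all_reals all_analysis.
Set Implicit Arguments.
Unset Strict Implicit.
Unset Printing Implicit Defensive.
Import Order.TTheory GRing.Theory Num.Theory.
Import numFieldNormedType.Exports.
Local Open Scope classical_set_scope.
Local Open Scope ring_scope.
Local Open Scope quotient_scope.

Definition period_lattice (R : realType) : {pred R} :=
  fun x => `[< exists k : int, x = k%:~R * (2 * pi) >].

Lemma period_lattice_zmod_closed (R : realType) :
  zmod_closed (@period_lattice R).
Proof.
split=> [|x y /asboolP[k ->] /asboolP[l ->]]; apply/asboolP.
  by exists 0; rewrite mul0r.
by exists (k - l); rewrite intrB mulrBl.
Qed.

HB.instance Definition _ (R : realType) :=
  GRing.isZmodClosed.Build R (@period_lattice R) (@period_lattice_zmod_closed R).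

(* R / 2 pi Z, with the quotient topology and the quotient group law. *)
Definition circle (R : realType) : Type :=
  quotient_topology (Quotient.quot (@period_lattice R)).

HB.instance Definition _ (R : realType) := PointedTopological.on (circle R).
HB.instance Definition _ (R : realType) := Quotient.on (circle R).
HB.instance Definition _ (R : realType) :=
  let I : zmodClosed R := @period_lattice R in
  GRing.isZmodule.Build (circle R) (@Quotient.addqA _ I) (@Quotient.addqC _ I)
    (@Quotient.add0q _ I) (@Quotient.addNq _ I).

(* T^N, with the product topology. *)
Definition torus (R : realType) (N : nat) : Type := {ptws 'I_N -> circle R}.

HB.instance Definition _ (R : realType) (N : nat) :=
  Topological.on (torus R N).

(* C^oo on the quotient manifold R / 2 pi Z: the 2 pi-periodic lift to R is
   infinitely differentiable. *)
Definition smooth (R : realType) (g : circle R -> R) : Prop :=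
  forall (n : nat) (x : R), derivable (derive1n n (g \o \pi_(circle R))) x 1.

Definition locally_constant_set (R : realType) (g : circle R -> R) :
    set (circle R) :=
  [set x | exists c : R, \forall y \near x, g y = c].

Definition dead_zone (R : realType) (g : circle R -> R) : set (circle R) :=
  [set x | \forall y \near x, g y = 0].

Definition simple_dead_zones (R : realType) (g : circle R -> R) : Prop :=
  finite_set [set connected_component (dead_zone g) x | x in dead_zone g] /\
  locally_constant_set g = dead_zone g.

Record coupling_function (R : realType) (g : circle R -> R) : Prop := {
  coupling_nonconstant : ~ (exists c : R, forall x, g x = c);
  coupling_smooth : smooth g;
  coupling_simple_dead_zones : simple_dead_zones g
}.

(* A directed graph on the vertex set 'I_N is identified with its edge set;
   (j, k) is the edge from j to k. *)
Definition loopless (N : nat) (H : {set 'I_N * 'I_N}) : Prop :=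
  forall k : 'I_N, (k, k) \notin H.

Definition effective_coupling_graph (R : realType) (N : nat)
    (g : circle R -> R) (theta : torus R N) : {set 'I_N * 'I_N} :=
  [set e : 'I_N * 'I_N |
    (e.1 != e.2) && (theta e.1 - theta e.2 \notin dead_zone g)].

(* Main.v *)
Require Import Defs.
From HB Require Import structures.
From mathcomp Require Import all_boot all_order all_algebra.
From mathcomp Require Import all_classical all_reals all_analysis.
From mathcomp Require Import zify ring lra.
Import Order.TTheory GRing.Theory Num.Theory.
Import numFieldNormedType.Exports.
Local Open Scope classical_set_scope.
Local Open Scope ring_scope.

(** A phase configuration is called generic when the differences
    d_(j,k) = theta_j - theta_k with j != k are pairwise distinct points of
    the circle, and distinct from 0.  Given such a configuration and a graph H,
    put a narrow smooth bump around each d_e with e in H and one more around 0,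
    narrow enough that no bump reaches another marked point: the sum of these
    bumps is the coupling function.  The bump at 0 sits at the value of the
    loops, so it does not affect the graph; it is there so that the empty graph
    also yields a non-constant function.

    The bump around p is F(cos(x - p) - c), where F(u) = exp(-1/u) for u > 0
    and F(u) = 0 otherwise, and c < 1 is close to 1; the cosine of x - p plays
    the role of the distance from x to p and makes periodicity automatic.
    Smoothness holds because the functions u^-k exp(-1/u), extended by 0, are
    differentiable with derivatives among their combinations
    ([is_derive_flat]), so that an algebra of functions containing the bumps
    is stable under differentiation ([trig_flat_derive]).  Once 2 c^2 - 1
    exceeds the cosine of every difference of two centres, the closed supports
    are disjoint ([circle_separation]).  The dead zone is then exactly the set
    where cos(x - p) < c for all centres p ([dead_zone_bumps]); a locally
    constant point inside a bump would make the cosine locally constant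
    ([locally_constant_bumps]); and the dead zone has finitely many components
    because, lifted to [0, 2 pi], it is a finite union of intervals
    ([finite_components_cos_lt]).

    Genericity is open as a finite conjunction of conditions of the form
    cos(...) != 1, the left-hand sides being continuous on the torus.  It is
    dense because, along the curve theta_i + 2^i u, each quantity
    d_e - d_f moves at a non-zero speed: the powers of 2 form a Sidon set
    ([expn2_sidon]).  Each condition therefore holds for all small u != 0. *)

(** * The flat function exp(-1/u) and its derivatives *)

Section flat.
Context {R : realType}.
Implicit Types (u t a c : R) (k : nat).

(** The factor u^-k makes the family closed under differentiation. *)
Definition flat k u : R := if 0 < u then expR (- u^-1) / u ^+ k else 0.

Lemma flat_gt0 k u : 0 < u -> 0 < flat k u.
Proof. by move=> u0; rewrite /flat u0 divr_gt0 ?expR_gt0 ?exprn_gt0. Qed.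

Lemma flat_eq0 k u : u <= 0 -> flat k u = 0.
Proof. by rewrite leNgt /flat => /negbTE ->. Qed.

Lemma flat_ge0 k u : 0 <= flat k u.
Proof. by case: (leP u 0) => [/flat_eq0 -> //|/flat_gt0 /ltW]. Qed.

(** This is the Caratheodory factorisation of [flat k] at 0, which reduces its
    differentiability there to the continuity of [flat k.+1]. *)
Lemma flatS k u : flat k u = flat k.+1 u * u.
Proof.
rewrite /flat; case: ltP => [u0|]; last by rewrite mul0r.
by rewrite exprSr invfM mulrA mulfVK // gt_eqF.
Qed.

Lemma flat0_inj u v : 0 < u -> 0 < v -> flat 0 u = flat 0 v -> u = v.
Proof.
move=> u0 v0; rewrite /flat u0 v0 !expr0 !divr1 => /expR_inj /oppr_inj.
exact: invr_inj.
Qed.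

(** The exponential series bounds exp(1/u) below by u^-(k+1) / (k+1)!. *)
Lemma flat_le k u : 0 <= u -> flat k u <= (k.+1)`!%:R * u.
Proof.
move=> u0; rewrite /flat; case: ltP => [{}u0|_]; last by rewrite mulr_ge0.
have f0 : 0 < (k.+1)`!%:R :> R by rewrite ltr0n fact_gt0.
have h : u^-1 ^+ k.+1 <= (k.+1)`!%:R * expR u^-1.
  rewrite -ler_pdivrMl // mulrC.
  have u1 : 0 <= u^-1 by rewrite invr_ge0 ltW.
  by apply: le_trans (expR_ge1Dxn k u1); rewrite lerDr.
rewrite expRN ler_pdivrMr ?exprn_gt0 // -mulrA -exprS.
rewrite -[leLHS]mul1r ler_pdivrMr ?expR_gt0 //.
by rewrite mulrAC -ler_pdivrMr ?exprn_gt0 // mul1r -exprVn.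
Qed.

Lemma continuous_flat0 k : {for (0:R), continuous (flat k)}.
Proof.
apply/cvgrPdist_le => e e0.
near=> u; rewrite (flat_eq0 k 0) // sub0r normrN ger0_norm ?flat_ge0 //.
have [u0|u0] := leP u 0; first by rewrite flat_eq0 // ltW.
apply: (le_trans (flat_le k _ (ltW u0))).
rewrite -ler_pdivlMl ?ltr0n ?fact_gt0 // ltW //.
apply: (le_lt_trans (ler_norm _)).
near: u; apply: (@nbhs0_lt _ R^o).
by rewrite mulr_gt0 // invr_gt0 ltr0n fact_gt0.
Unshelve. all: by end_near. Qed.

Lemma is_derive_flat k u :
  is_derive u 1 (flat k) (flat k.+2 u - k%:R * flat k.+1 u).
Proof.
have [u0|u0|->] := ltgtP u 0; last first.
- rewrite !flat_eq0 // mulr0 subr0; apply/is_derive1_caratheodory.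
  exists (flat k.+1); split; [|exact: continuous_flat0|exact: flat_eq0].
  by move=> z; rewrite (flat_eq0 k 0) // !subr0 -flatS.
- have u_neq0 : u != 0 by rewrite gt_eqF.
  have dV := is_deriveV u_neq0 (is_derive_id u 1).
  have dE := is_derive1_comp (is_derive_expR _) (is_deriveN dV).
  have h := is_deriveM dE (is_deriveX k dV).
  apply: near_eq_is_derive (is_derive_eq h _).
    near=> v; rewrite /flat ifT; last by near: v; exact: lt_nbhsr.
    by rewrite -exprVn -[LHS]/(expR (- v^-1) * ([eta GRing.inv] ^+ k) v) exprfctE.
  rewrite /flat u0 /= /GRing.scale/= -[(- [eta GRing.inv]) u]/(- u^-1).
  rewrite !exprfctE !mulr1 opprK mulrN addrC.
  case: k {h} => [|k] /=; rewrite ?expr0 ?mul0r ?subr0 ?oppr0 ?addr0.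
    by rewrite mul1r mulr0 addr0.
  rewrite -!exprVn; move: (expR _) => E; move: (u^-1) => w; rewrite !exprS.
  ring.
- rewrite !flat_eq0 ?ltW // mulr0 subr0.
  apply: (@near_eq_is_derive _ _ _ (cst 0)).
  near=> v; rewrite /= flat_eq0 // ltW //.
  by near: v; exact: lt_nbhsl.
Unshelve. all: by end_near. Qed.

End flat.

(** * An algebra of functions stable under differentiation *)

Section flat_cos.
Context {R : realType} (c : R).

(** The algebra generated by the translates of the bump profile and of its
    derivatives; [cos] and [sin] are included because the chain rule produces
    them. *)
Inductive trig_flat : (R -> R) -> Prop :=
| TrigFlatCst b : trig_flat (cst b)
| TrigFlatCos a : trig_flat (fun t => cos (t - a))
| TrigFlatSin a : trig_flat (fun t => sin (t - a))
| TrigFlatFlat k a : trig_flat (fun t => flat k (cos (t - a) - c))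
| TrigFlatAdd f g : trig_flat f -> trig_flat g -> trig_flat (f + g)
| TrigFlatMul f g : trig_flat f -> trig_flat g -> trig_flat (f * g).

Lemma trig_flat_derive f : trig_flat f ->
  exists2 f', trig_flat f' & forall t : R, is_derive t 1 f (f' t).
Proof.
have dsub (a t : R) : is_derive t 1 (fun t => t - a) 1.
  exact: (is_derive_shift t 1 (- a)).
have dcos (a t : R) : is_derive t 1 (fun t => cos (t - a)) (- sin (t - a)).
  have := @is_derive1_comp _ cos (fun t => t - a) t _ _ (is_derive_cos _) (dsub a t).
  by rewrite mulr1.
elim=> {f} [b|a|a|k a|f g _ [f' nf' df] _ [g' ng' dg]|f g nf [f' nf' df] ng [g' ng' dg]].
- by exists (cst 0) => [|t]; [exact: TrigFlatCst|exact: is_derive_cst].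
- exists (cst (-1) * (fun t => sin (t - a))) => [|t].
    by apply: TrigFlatMul; [exact: TrigFlatCst|exact: TrigFlatSin].
  by apply: is_derive_eq (dcos a t) _; exact/esym/mulN1r.
- exists (fun t => cos (t - a)) => [|t]; first exact: TrigFlatCos.
  have := @is_derive1_comp _ sin (fun t => t - a) t _ _ (is_derive_sin _) (dsub a t).
  by rewrite mulr1.
- exists (((fun t => flat k.+2 (cos (t - a) - c))
      + cst (- k%:R) * (fun t => flat k.+1 (cos (t - a) - c)))
      * (cst (-1) * (fun t => sin (t - a)))) => [|t].
    by do !(apply: TrigFlatAdd || apply: TrigFlatMul || apply: TrigFlatCst ||
      apply: TrigFlatFlat || apply: TrigFlatSin).
  have dc : is_derive t 1 (fun t => cos (t - a) - c) (- sin (t - a)).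
    by have := is_deriveB (dcos a t) (is_derive_cst c t 1); rewrite subr0.
  apply: is_derive_eq (@is_derive1_comp _ (flat k) (fun t => cos (t - a) - c) t _ _
    (is_derive_flat k _) dc) _.
  rewrite -[RHS]/((flat k.+2 (cos (t - a) - c)
    + - k%:R * flat k.+1 (cos (t - a) - c)) * (-1 * sin (t - a))).
  by rewrite mulN1r mulNr.
- exists (f' + g') => [|t]; first exact: TrigFlatAdd.
  exact: is_deriveD (df t) (dg t).
- exists (f * g' + g * f') => [|t]; last exact: is_deriveM (df t) (dg t).
  by apply: TrigFlatAdd; exact: TrigFlatMul.
Qed.

Lemma trig_flat_derivable f n t : trig_flat f -> derivable (derive1n n f) t 1.
Proof.
move=> nf; have : trig_flat (derive1n n f).
  elim: n => [//|n] /trig_flat_derive [g ng dg].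
  suff -> : derive1n n.+1 f = g by [].
  by apply/funext => x; rewrite derive1nS derive1E; have [_ ->] := dg x.
by move=> /trig_flat_derive[g _ /(_ t) []].
Qed.

End flat_cos.

(** * Trigonometry on the circle *)

Section circle_trig.
Context {R : realType}.
Local Open Scope quotient_scope.
Implicit Types (s t a : R) (x y p : circle R).

Local Notation qpi := (\pi_(circle R)).

Lemma pi_circleB s t : qpi (s - t) = qpi s - qpi t.
Proof.
have -> : qpi s - qpi t = Quotient.add (qpi s) (Quotient.opp (qpi t)) by [].
by apply: etrans (Quotient.pi_add _ _ _) _; congr Quotient.add; exact: Quotient.pi_opp.
Qed.

Lemma pi_circle_eqP s t :
  qpi s = qpi t <-> exists k : int, s - t = k%:~R * (2 * pi).
Proof.
have E := Quotient.idealrBE (@period_lattice R) s t.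
split=> [st|h].
  by have : s - t \in @period_lattice R; [rewrite E; apply/eqP|move/asboolP].
have : s - t \in @period_lattice R by apply/asboolP.
by rewrite E => /eqP.
Qed.

Lemma cosD2pi_int t (k : int) : cos (t + k%:~R * (2 * pi)) = cos t.
Proof.
have h n (x : R) : cos (x + n%:R * (2 * pi)) = cos x.
  by rewrite mulr_natl (mulrC 2) mulr_natr (periodicn (@cosD2pi R)).
case: k => n; first exact: h.
by rewrite NegzE mulrNz mulNr -[in RHS](subrK (n.+1%:R * (2 * pi)) t) h.
Qed.

(** The value does not depend on the representative: see [circle_cosE]. *)
Definition circle_cos x : R := cos (repr x).
Definition circle_sin x : R := sin (repr x).

Lemma circle_cosE t : circle_cos (qpi t) = cos t.
Proof.
have /pi_circle_eqP[k] := reprK (qpi t).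
by move/eqP; rewrite subr_eq addrC /circle_cos => /eqP ->; rewrite cosD2pi_int.
Qed.

Lemma circle_sinE t : circle_sin (qpi t) = sin t.
Proof.
have /pi_circle_eqP[k] := reprK (qpi t).
move/eqP; rewrite subr_eq addrC /circle_sin => /eqP ->.
by rewrite -!cosBpihalf addrAC cosD2pi_int.
Qed.

Lemma continuous_circle_cos : continuous circle_cos.
Proof.
apply/quotient_continuous; have -> : circle_cos \o qpi = cos.
  by apply/funext => t; exact: circle_cosE.
exact: continuous_cos.
Qed.

Lemma continuous_circle_sin : continuous circle_sin.
Proof.
apply/quotient_continuous; have -> : circle_sin \o qpi = sin.
  by apply/funext => t; exact: circle_sinE.
exact: continuous_sin.
Qed.

Lemma circle_ind (P : circle R -> Prop) : (forall t, P (qpi t)) -> forall x, P x.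
Proof. by move=> h x; rewrite -(reprK x). Qed.

Lemma circle_cosB x y :
  circle_cos (x - y) = circle_cos x * circle_cos y + circle_sin x * circle_sin y.
Proof.
elim/circle_ind: x => s; elim/circle_ind: y => t.
by rewrite -pi_circleB !circle_cosE !circle_sinE cosB.
Qed.

Lemma circle_sinB x y :
  circle_sin (x - y) = circle_sin x * circle_cos y - circle_cos x * circle_sin y.
Proof.
elim/circle_ind: x => s; elim/circle_ind: y => t.
by rewrite -pi_circleB !circle_cosE !circle_sinE sinB.
Qed.

Lemma circle_cos_piB t p : circle_cos (qpi t - p) = cos (t - repr p).
Proof. by rewrite -[in LHS](reprK p) -pi_circleB circle_cosE. Qed.

Lemma circle_cosC x y : circle_cos (x - y) = circle_cos (y - x).
Proof. by rewrite !circle_cosB mulrC [X in _ + X]mulrC. Qed.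

Lemma circle_cos_le1 x : circle_cos x <= 1. Proof. exact: cos_le1. Qed.

Lemma circle_cos2Dsin2 x : circle_cos x ^+ 2 + circle_sin x ^+ 2 = 1.
Proof. exact: cos2Dsin2. Qed.

Lemma circle_cos_subr0 x : circle_cos (x - x) = 1.
Proof. by rewrite circle_cosB -!expr2 circle_cos2Dsin2. Qed.

Lemma continuous_circle_cosB p : continuous (fun x => circle_cos (x - p)).
Proof.
rewrite (funext (fun x => circle_cosB x p)) => x.
exact: (cvgD (cvgM (continuous_circle_cos x) (cvg_cst _))
  (cvgM (continuous_circle_sin x) (cvg_cst _))).
Qed.

(** Subtract from a representative the multiple of 2 pi given by the integer
    part of its quotient by 2 pi. *)
Lemma circle_lift x : exists2 t, qpi t = x & 0 <= t <= 2 * pi.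
Proof.
have p0 : 0 < 2 * pi :> R by rewrite mulr_gt0 ?pi_gt0.
set k := Num.floor (repr x / (2 * pi)).
exists (repr x - k%:~R * (2 * pi)).
  rewrite -[RHS]reprK; apply/pi_circle_eqP; exists (- k).
  by rewrite mulrNz mulNr addrAC subrr add0r.
have /andP[h1 h2] := Num.Theory.floor_itv (repr x / (2 * pi)).
rewrite subr_ge0 -ler_pdivlMr // h1 /= lerBlDr -[X in X + _]mul1r -mulrDl.
by rewrite -ler_pdivrMr // ltW // addrC -[1]/(1%:~R) -intrD.
Qed.

(** Neighbourhoods on the circle pull back along the continuous projection;
    this turns local conditions on the circle into conditions on the line. *)
Lemma near_lift (P : circle R -> Prop) t : (\forall x \near qpi t, P x) ->
  exists2 r, 0 < r & forall u, `|u - t| < r -> P (qpi u).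
Proof.
move=> h; have : \forall u \near t, P (qpi u) by exact: (pi_continuous h).
move=> /nbhs_ballP[r /= r0 hr]; exists r => // u ut.
by apply: hr; rewrite /ball /= distrC.
Qed.

(** Write c = cos b.  Two arcs of half-width b around p and q that meet force p
    and q to be within 2 b of each other, and cos (2 b) = 2 c^2 - 1. *)
Lemma circle_separation p q x c : 0 <= c -> c <= circle_cos (x - p) ->
  c <= circle_cos (x - q) -> 2 * c ^+ 2 - 1 <= circle_cos (p - q).
Proof.
move=> c0 hp hq; have -> : p - q = (x - q) - (x - p).
  by rewrite opprB [RHS]addrC addrA subrK.
rewrite circle_cosB.
have := circle_cos2Dsin2 (x - p); have := circle_cos2Dsin2 (x - q).
move: hp hq.
move: (circle_cos (x - p)) (circle_cos (x - q)) (circle_sin (x - p)) (circle_sin (x - q)).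
move=> u v s t hu hv e1 e2.
have huv : c ^+ 2 <= v * u by rewrite expr2 ler_pM.
have hu2 : c ^+ 2 <= u ^+ 2 by rewrite lerXn2r ?nnegrE // (le_trans c0).
have hv2 : c ^+ 2 <= v ^+ 2 by rewrite lerXn2r ?nnegrE // (le_trans c0).
(* The product of the sines is at least - (s^2 + t^2) / 2 >= - (1 - c^2). *)
have := sqr_ge0 (s + t); rewrite sqrrD mulr2n (mulrC s t); lra.
Qed.
End circle_trig.

(** * Finiteness of the number of components *)

Section components.
Context {R : realType}.
Local Open Scope quotient_scope.
Local Notation qpi := (\pi_(circle R)).

Definition finite_interval_union (D : set R) :=
  exists (J : finType) (I : J -> set R),
    (forall j, is_interval (I j)) /\ D = \bigcup_j I j.

Lemma finite_interval_unionI (A B : set R) : finite_interval_union A ->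
  finite_interval_union B -> finite_interval_union (A `&` B).
Proof.
move=> [J [I [hI ->]]] [K [L [hL ->]]].
exists (J * K)%type, (fun jk => I jk.1 `&` L jk.2); split.
  move=> [j k] x y /= [Ix Lx] [Iy Ly] z xzy.
  by split; [exact: hI Ix Iy _ xzy|exact: hL Lx Ly _ xzy].
apply/seteqP; split=> [x [[j _ Ix] [k _ Lx]]|x [[j k] _ /= [Ix Lx]]].
  by exists (j, k).
by split; [exists j|exists k].
Qed.

(** The projection of an interval contained in the lift of A is connected, hence
    lies in one component; the intervals exhaust A, so there are at most as many
    components as intervals. *)
Lemma finite_components (A : set (circle R)) :
  finite_interval_union (`[0, 2 * pi] `&` qpi @^-1` A) ->
  finite_set [set connected_component A x | x in A].
Proof.
move=> [J [I [hI eI]]].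
(* If I j is empty the default point 0 gives a spurious but harmless value. *)
pose F j := connected_component A (qpi (xget 0 (I j))).
apply: (@sub_finite_set _ _ [set F j | j in [set: J]]); last first.
  exact/finite_image/finite_finset.
move=> _ [x Ax <-]; have [t tx t2pi] := circle_lift x.
have [j _ It] : (\bigcup_j I j) t by rewrite -eI; split; rewrite /= ?in_itv /= ?tx.
exists j => //; apply: same_connected_component.
have IA s : I j s -> A (qpi s).
  by move=> Is; have [] : (`[0, 2 * pi] `&` qpi @^-1` A) s by rewrite eI; exists j.
exists (qpi @` I j); last by exists t.
split; [by exists (xget 0 (I j)) => //; exact: xgetPex (ex_intro _ t It)| |].
  by move=> _ [s /IA As <-].
apply: connected_continuous_connected; first exact/connected_intervalP.
by apply: continuous_subspaceT; exact: pi_continuous.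
Qed.

(** On [0, pi] the cosine decreases; on [pi, 2 pi] reflect by z |-> 2 pi - z. *)
Lemma cos_lt_cos (y b : R) : 0 < b < pi -> `|y| <= 2 * pi ->
  (cos y < cos b) = (b < `|y| < 2 * pi - b).
Proof.
move=> /andP[b0 bpi]; rewrite -cos_norm; move: `|y| (normr_ge0 y) => z z0 z2pi.
have [zpi|piz] := leP z pi.
  rewrite ltr_cos ?in_itv /= ?z0 ?zpi ?ltW //.
  suff -> : z < 2 * pi - b by rewrite andbT.
  lra.
have -> : cos z = cos (2 * pi - z).
  by rewrite -[RHS]cosN opprB -[RHS](cosD2pi_int _ 1) mul1r subrK.
rewrite ltr_cos ?in_itv /=; [|by apply/andP; split; lra..].
have -> : b < z by lra.
by rewrite /=; apply/idP/idP; lra.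
Qed.

(** Since t and a lie in [0, 2 pi], their difference lies in [-2 pi, 2 pi],
    where the condition cuts out one interval on each side of a. *)
Lemma cos_lt_interval_union (a c : R) : 0 <= a <= 2 * pi -> -1 < c < 1 ->
  finite_interval_union (`[0, 2 * pi] `&` [set t | cos (t - a) < c]).
Proof.
move=> /andP[a0 a2pi] /andP[c1 c2].
have cE : c = cos (acos c) by rewrite acosK // in_itv /= !ltW.
set b := acos c in cE.
have b0pi : 0 < b < pi by rewrite acos_gt0 ?acos_ltpi ?c1 ?c2 ?ltW.
exists bool, (fun l => `[0, 2 * pi] `&`
  [set` if l then `]a - (2 * pi - b), a - b[ else `]a + b, a + (2 * pi - b)[]); split.
  move=> l x y [x1 x2] [y1 y2] z xzy; split.
    exact: interval_is_interval x1 y1 _ xzy.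
  by case: l x2 y2 => x2 y2; exact: interval_is_interval x2 y2 _ xzy.
apply/seteqP; split => t /=.
  rewrite in_itv /= => -[/andP[t0 t1]]; rewrite cE cos_lt_cos //; last first.
    by rewrite ler_norml; apply/andP; split; lra.
  case: (leP 0 (t - a)) => ta.
    rewrite ger0_norm // => /andP[h1 h2]; exists false => //; split.
      by rewrite /= in_itv /= t0 t1.
    by rewrite /= in_itv /=; apply/andP; split; lra.
  rewrite ltr0_norm // => /andP[h1 h2]; exists true => //; split.
    by rewrite /= in_itv /= t0 t1.
  by rewrite /= in_itv /=; apply/andP; split; lra.
move=> [l _ [] /=]; rewrite in_itv /= => /andP[t0 t1] ht; split.
  by rewrite t0 t1.
rewrite cE cos_lt_cos //; last by rewrite ler_norml; apply/andP; split; lra.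
move: b0pi ht => /andP[b0 bpi].
case: l; rewrite /= in_itv /= => /andP[h1 h2].
  by rewrite ltr0_norm; [apply/andP; split|]; lra.
by rewrite gtr0_norm; [apply/andP; split|]; lra.
Qed.

Lemma finite_components_cos_lt (s : seq (circle R)) (c : R) : -1 < c < 1 ->
  let A := [set x | forall p, p \in s -> circle_cos (x - p) < c] in
  finite_set [set connected_component A x | x in A].
Proof.
move=> c1 A; apply: finite_components; rewrite {}/A.
elim: s => [|p s IH].
  exists unit, (fun=> [set` `[0, 2 * pi]]); split=> [_|]; first exact: interval_is_interval.
  by apply/seteqP; split=> t /= => [[h _]|[]]; [exists tt|].
have [a <- a2pi] := circle_lift p.
rewrite [X in finite_interval_union X](_ : _ =
  (`[0, 2 * pi] `&` [set t | cos (t - a) < c]) `&`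
  (`[0, 2 * pi] `&` qpi @^-1` [set x | forall p, p \in s -> circle_cos (x - p) < c])).
  by apply: finite_interval_unionI => //; exact: cos_lt_interval_union.
apply/seteqP; split=> t /= [h ht].
  split; split=> //; last by move=> q qs; apply: ht; rewrite inE qs orbT.
  by rewrite -circle_cosE pi_circleB; apply: ht; rewrite inE eqxx.
case: ht h => _ ht [h ht0]; split => // q; rewrite inE => /orP[/eqP ->|/ht //].
by rewrite -pi_circleB circle_cosE.
Qed.
End components.

(** * Local rigidity of the cosine *)

Section cos_local.
Context {R : realType}.
Implicit Types t r : R.

(** Comparing cos (t + e) and cos (t - e) with cos t for a single e in ]0, pi[
    gives sin t = 0 and cos t = 0. *)
Lemma cos_not_locally_constant t r : 0 < r ->
  ~ (forall s, `|s - t| < r -> cos s = cos t).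
Proof.
move=> r0 h; pose e := Num.min (r / 2) 1.
have e0 : 0 < e by rewrite lt_min divr_gt0 /=.
have er : `|e| < r by rewrite gtr0_norm // gt_min ltr_pdivrMr // ltr_pMr ?ltr1n.
have epi : e < pi.
  have e1 : e <= 1 by rewrite ge_min lexx orbT.
  have := pi_ge2 R; lra.
have hp : cos (t + e) = cos t by apply: h; rewrite addrC addKr.
have hm : cos (t - e) = cos t by apply: h; rewrite addrC addKr normrN.
have se : 0 < sin e by rewrite sin_gt0_pi ?e0.
have ce : cos e < 1 by rewrite -[ltRHS]cos0 ltr_cos ?in_itv /= ?pi_ge0 ?lexx ?ltW.
move: hp hm; rewrite cosD cosB => hp hm.
have st : sin t = 0.
  by apply: (mulIf (lt0r_neq0 se)); rewrite mul0r; lra.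
have ct : cos t = 0.
  have e1 : 1 - cos e != 0 by rewrite subr_eq0 gt_eqF.
  by apply: (mulIf e1); rewrite mul0r mulrBr; lra.
have := cos2Dsin2 t; rewrite st ct !expr0n /= addr0 => /esym/eqP.
by rewrite oner_eq0.
Qed.

(** At a local maximum the derivative - sin t vanishes. *)
Lemma cos_local_max t r : 0 < r ->
  (forall s, `|s - t| < r -> cos s <= cos t) -> cos t ^+ 2 = 1.
Proof.
move=> r0 h.
have H : is_derive t 1 cos 0.
  apply: (@derive1_at_max _ cos (t - r) (t + r)).
  - lra.
  - by move=> *; exact: derivable_cos.
  - by rewrite in_itv /=; apply/andP; split; lra.
  - move=> s; rewrite in_itv /= => /andP[h1 h2]; apply: h.
    by rewrite ltr_norml; apply/andP; split; lra.
have [_ e1] := H; have [_] := is_derive_cos t; rewrite e1 => /esym/eqP.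
by rewrite oppr_eq0 cos2sin2 => /eqP ->; rewrite expr0n subr0.
Qed.
End cos_local.

(** * Sums of disjoint bumps are coupling functions *)

Section bumps.
Context {R : realType} (c : R) (s : seq (circle R)).
Hypotheses (c01 : 0 < c < 1) (s_uniq : uniq s) (s_neq0 : s != [::]).
Hypothesis s_sep : {in s &, forall p q, p != q ->
  circle_cos (p - q) < 2 * c ^+ 2 - 1}.
Local Open Scope quotient_scope.
Local Notation qpi := (\pi_(circle R)).
Implicit Types (x p : circle R) (t : R).

Definition bumps x : R := \sum_(p <- s) flat 0 (circle_cos (x - p) - c).

Lemma bumps_gt0 x p : p \in s -> c < circle_cos (x - p) -> 0 < bumps x.
Proof.
move=> ps cx; rewrite /bumps (big_rem p) //= ltr_pwDl //.
  by rewrite flat_gt0 // subr_gt0.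
by apply: sumr_ge0 => q _; exact: flat_ge0.
Qed.

Lemma bumps_eq0 x : (forall p, p \in s -> circle_cos (x - p) <= c) -> bumps x = 0.
Proof.
move=> h; rewrite /bumps big1_seq // => p /andP[_ ps].
by rewrite flat_eq0 // subr_le0 h.
Qed.

(** Inside one bump the other bumps vanish, since the supports are disjoint. *)
Lemma bumps_single x p : p \in s -> c < circle_cos (x - p) ->
  bumps x = flat 0 (circle_cos (x - p) - c).
Proof.
move=> ps cx; rewrite /bumps (bigD1_seq p) //= big1_seq ?addr0 // => q /andP[qp qs].
rewrite flat_eq0 // subr_le0 leNgt; apply/negP => cq.
have /andP[c0 _] := c01.
have := s_sep _ _ qs ps qp; rewrite ltNge => /negP; apply.
exact: circle_separation (ltW c0) (ltW cq) (ltW cx).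
Qed.

Lemma bumps_smooth : smooth bumps.
Proof.
move=> n t; apply: (@trig_flat_derivable _ c).
have -> : bumps \o qpi =
    \sum_(p <- s) (fun t => flat 0 (cos (t - repr p) - c)).
  apply/funext => u; rewrite fct_sumE; apply: eq_bigr => p _.
  by rewrite circle_cos_piB.
elim/big_ind: _ => [|f g|p _]; [exact: TrigFlatCst|exact: TrigFlatAdd|].
exact: TrigFlatFlat.
Qed.

(** A point of the dead zone on the boundary of a bump, where cos(x - p) = c,
    would be a local maximum of the cosine, whereas c^2 != 1. *)
Lemma dead_zone_bumps :
  dead_zone bumps = [set x | forall p, p \in s -> circle_cos (x - p) < c].
Proof.
have /andP[c0 c1] := c01.
apply/seteqP; split => x /= hx.
  move=> p ps; rewrite ltNge; apply/negP => cx.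
  move: hx cx; rewrite -(reprK x); move: (repr x) => t /near_lift[r r0 hr].
  rewrite circle_cos_piB => ct.
  have hle u : `|u - t| < r -> cos (u - repr p) <= c.
    move=> /hr gu; rewrite leNgt; apply/negP => cu.
    have : 0 < bumps (qpi u).
      by apply: (bumps_gt0 _ _ ps); rewrite circle_cos_piB.
    by rewrite gu ltxx.
  have ct' : cos (t - repr p) = c.
    by apply/le_anti; rewrite ct hle // subrr normr0.
  have : cos (t - repr p) ^+ 2 = 1.
    apply: (cos_local_max _ _ r0) => u hu; rewrite ct'.
    rewrite -[u](addrK (repr p)); apply: hle.
    by rewrite opprB addrA in hu.
  by rewrite ct' => /eqP; rewrite sqrp_eq1 ?ltW // lt_eqF.
have H : \forall y \near x, forall i : 'I_(size s), circle_cos (y - s`_i) < c.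
  have := @filter_forall _ _ (fun (i : 'I_(size s)) y => circle_cos (y - s`_i) < c)
    (nbhs x) (nbhs_filter x).
  apply => i.
  have := @continuous_circle_cosB _ s`_i x.
  by move=> /cvgr_lt; apply; apply: hx; exact: mem_nth.
apply: filterS H => y hy; apply: bumps_eq0 => p /(nthP 0)[i si <-].
exact: ltW (hy (Ordinal si)).
Qed.

(** Inside a bump the profile is injective, so a constant sum would make the
    cosine locally constant; outside all bumps the sum is 0. *)
Lemma locally_constant_bumps : locally_constant_set bumps = dead_zone bumps.
Proof.
apply/seteqP; split => x /=; last by exists 0.
move=> [v hv]; have gx : bumps x = v := nbhs_singleton hv.
have [[p ps cx]|hx] := pselect (exists2 p, p \in s & c < circle_cos (x - p)).
  exfalso; move: hv gx cx; rewrite -(reprK x); move: (repr x) => t hv gx cx.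
  have near_c : \forall y \near qpi t, c < circle_cos (y - p).
    by have := @continuous_circle_cosB _ p (qpi t) => /cvgr_gt; apply.
  have [r r0 hr] := near_lift _ _ (filterI near_c hv).
  apply: (@cos_not_locally_constant _ (t - repr p) r r0) => u hu.
  have {hr}[cu gu] : c < cos u /\ bumps (qpi (u + repr p)) = v.
    have [|h1 h2] := hr (u + repr p); first by rewrite opprB addrA in hu.
    split => //; move: h1.
    by rewrite circle_cos_piB addrK.
  move: gx; rewrite (bumps_single _ _ ps cx) => gx.
  have cu' : c < circle_cos (qpi (u + repr p) - p).
    by rewrite circle_cos_piB addrK.
  move: gu; rewrite (bumps_single _ _ ps) // -gx => /flat0_inj.
  rewrite !subr_gt0 => /(_ cu' cx) /addIr.
  by rewrite !circle_cos_piB addrK.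
suff v0 : v = 0 by move: hv; rewrite v0.
rewrite -gx bumps_eq0 // => p ps; rewrite leNgt; apply/negP => cx.
by apply: hx; exists p.
Qed.

Lemma bumps_coupling : coupling_function bumps.
Proof.
split.
(* A constant function would have the whole circle as its dead zone, but the
   centres of the bumps are not in it. *)
- move=> [v hv]; have [p ps] : exists p, p \in s.
    by case: (s) s_neq0 => // p l _; exists p; rewrite mem_head.
  have px : circle_cos (p - p) > c by rewrite circle_cos_subr0; case/andP: c01.
  have : dead_zone bumps p.
    by rewrite -locally_constant_bumps; exists v; exact: (@filterE _ (nbhs p) (nbhs_filter p) _ hv).
  by rewrite dead_zone_bumps => /(_ p ps); rewrite ltNge ltW.
- exact: bumps_smooth.
- split; last exact: locally_constant_bumps.
  rewrite dead_zone_bumps; apply: finite_components_cos_lt.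
  by case/andP: c01 => c0 ->; rewrite (lt_trans _ c0).
Qed.
End bumps.

(** * Prescribing the dead points among finitely many points *)

Section separating.
Context {R : realType}.
Implicit Types (x p q : circle R).

Lemma seq_lt1_bound (l : seq R) : {in l, forall v, v < 1} ->
  exists2 M, 0 <= M < 1 & {in l, forall v, v <= M}.
Proof.
elim: l => [|v l IH] hl; first by exists 0; rewrite ?lexx ?ltr01.
have [|M /andP[M0 M1] hM] := IH; first by move=> w wl; apply: hl; rewrite inE wl orbT.
exists (Num.max v M) => [|w].
  by rewrite le_max M0 orbT gt_max M1 hl ?mem_head.
rewrite inE => /orP[/eqP ->|/hM wM]; rewrite le_max ?lexx //.
by rewrite wM orbT.
Qed.

Lemma separation_radius (Q : seq (circle R)) :
  {in Q &, forall p q, p != q -> circle_cos (p - q) != 1} ->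
  exists2 c : R, 0 < c < 1 &
    {in Q &, forall p q, p != q -> circle_cos (p - q) < 2 * c ^+ 2 - 1}.
Proof.
move=> hQ.
pose l := [seq v <- [seq circle_cos (p - q) | p <- Q, q <- Q] | v < 1].
have [|M /andP[M0 M1] hM] := @seq_lt1_bound l.
  by move=> v; rewrite mem_filter => /andP[].
(* With c = 1 - (1 - M) / 4 one has 1 - c^2 < (1 - M) / 2. *)
exists ((3 + M) / 4) => [|p q pQ qQ pq]; first by apply/andP; split; lra.
have : circle_cos (p - q) <= M.
  apply: hM; rewrite mem_filter lt_neqAle hQ // circle_cos_le1 /=.
  by apply/allpairsP; exists (p, q).
nra.
Qed.

Lemma coupling_with_dead_points (Q s : seq (circle R)) :
  {in Q &, forall p q, p != q -> circle_cos (p - q) != 1} ->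
  {subset s <= Q} -> s != [::] ->
  exists2 g, coupling_function g & {in Q, forall q, dead_zone g q <-> q \notin s}.
Proof.
move=> hQ sQ s0; have [c c01 hc] := separation_radius _ hQ.
have us0 : undup s != [::] by apply: contra s0 => /eqP/undup_nil ->.
have su : {in undup s &, forall p q, p != q -> circle_cos (p - q) < 2 * c ^+ 2 - 1}.
  by move=> p q; rewrite !mem_undup => /sQ pQ /sQ qQ; exact: hc.
exists (bumps c (undup s)).
  exact: bumps_coupling c01 (undup_uniq s) us0 su.
move=> q qQ; rewrite dead_zone_bumps ?undup_uniq //=; split => [h|qs p].
  apply/negP => qs; have := h q; rewrite mem_undup qs circle_cos_subr0 => /(_ isT).
  by case/andP: c01 => _ /ltW; rewrite leNgt => /negP.
rewrite mem_undup => ps; have qp : q != p by apply: contraNneq qs => ->.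
(* The bound 2 c^2 - 1 is below c, because (2 c + 1) (c - 1) < 0. *)
apply: (lt_le_trans (hc q p qQ (sQ p ps) qp)).
case/andP: c01 => c0 c1; nra.
Qed.
End separating.

(** * Genericity *)

(** The larger exponents agree: if b < d then 2^a + 2^b <= 2^(b+1) <= 2^d. *)
Lemma expn2_sidon_ordered (a b c d : nat) : (a <= b)%N -> (c <= d)%N ->
  (2 ^ a + 2 ^ b = 2 ^ c + 2 ^ d)%N -> a = c /\ b = d.
Proof.
move=> ab cd h.
have main (u v w z : nat) : (u <= v)%N -> (w <= z)%N ->
    (2 ^ u + 2 ^ v = 2 ^ w + 2 ^ z)%N -> (z <= v)%N.
  move=> uv wz e; rewrite leqNgt; apply/negP => vz.
  have h1 : (2 ^ u <= 2 ^ v)%N by rewrite leq_exp2l.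
  have h2 : (2 ^ v.+1 <= 2 ^ z)%N by rewrite leq_exp2l.
  have h3 : (0 < 2 ^ w)%N by rewrite expn_gt0.
  move: h2; rewrite expnS; lia.
have bd : b = d by apply/eqP; rewrite eqn_leq (main _ _ _ _ ab cd h) (main _ _ _ _ cd ab).
split=> //; move: h; rewrite bd => /addIn/eqP.
by rewrite eqn_exp2l // => /eqP.
Qed.

Lemma expn2_sidon (a b c d : nat) : (2 ^ a + 2 ^ b = 2 ^ c + 2 ^ d)%N ->
  (a = c /\ b = d) \/ (a = d /\ b = c).
Proof.
wlog ab : a b / (a <= b)%N => [hw|].
  have [/hw //|/ltnW ba h] := leqP a b.
  by have := hw _ _ ba (etrans (addnC _ _) h); tauto.
wlog cd : c d / (c <= d)%N => [hw|].
  have [/hw //|/ltnW dc h] := leqP c d.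
  by have := hw _ _ dc (etrans h (addnC _ _)); tauto.
by left; exact: expn2_sidon_ordered.
Qed.

Section generic.
Context {R : realType} (N : nat).
Local Open Scope quotient_scope.
Local Notation qpi := (\pi_(circle R)).
Implicit Types (theta : torus R N) (e f : 'I_N * 'I_N).

Definition phase_difference theta e : circle R := theta e.1 - theta e.2.

(** Separation is expressed through [circle_cos] rather than as an inequality of
    points so that openness is immediate.  The second edge is allowed to be a
    loop, whose phase difference is 0. *)
Definition separated_pair (ef : ('I_N * 'I_N) * ('I_N * 'I_N)) theta : Prop :=
  ef.1.1 != ef.1.2 -> ef.1 != ef.2 ->
  circle_cos (phase_difference theta ef.1 - phase_difference theta ef.2) != 1.

Definition generic_phases : set (torus R N) :=
  [set theta | forall ef, separated_pair ef theta].

(** A substitute for continuity into the circle, which passes to differences by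
    the addition formulas. *)
Definition trig_continuous {T : topologicalType} (h : T -> circle R) :=
  continuous (circle_cos \o h) /\ continuous (circle_sin \o h).

Lemma trig_continuousB (T : topologicalType) (h k : T -> circle R) :
  trig_continuous h -> trig_continuous k -> trig_continuous (fun x => h x - k x).
Proof.
move=> [hc hs] [kc ks]; split.
  rewrite (_ : _ \o _ = (circle_cos \o h) * (circle_cos \o k)
    + (circle_sin \o h) * (circle_sin \o k)).
    move=> x; exact: (cvgD (cvgM (hc x) (kc x)) (cvgM (hs x) (ks x))).
  by apply/funext => x; exact: circle_cosB.
rewrite (_ : _ \o _ = (circle_sin \o h) * (circle_cos \o k)
  - (circle_cos \o h) * (circle_sin \o k)).
  move=> x; exact: (cvgB (cvgM (hs x) (kc x)) (cvgM (hc x) (ks x))).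
by apply/funext => x; exact: circle_sinB.
Qed.

Lemma trig_continuous_coord (i : 'I_N) : trig_continuous (fun theta => theta i).
Proof.
have pc : continuous (fun theta => theta i) by exact: (@proj_continuous 'I_N (fun=> circle R) i).
split => theta; apply: continuous_comp; [exact: pc| |exact: pc|].
  exact: continuous_circle_cos.
exact: continuous_circle_sin.
Qed.

Lemma open_generic_phases : open generic_phases.
Proof.
rewrite openE => theta ht; rewrite /interior.
apply: (@filter_forall _ _ separated_pair _ (nbhs_filter theta)) => ef.
rewrite /separated_pair; have [h1|] := boolP (ef.1.1 != ef.1.2); last by move=> _; exact: (@filterE _ _ (nbhs_filter theta)).
have [h2|] := boolP (ef.1 != ef.2); last by move=> _; exact: (@filterE _ _ (nbhs_filter theta)).
have [hc _] : trig_continuous (fun theta => phase_difference theta ef.1 - phase_difference theta ef.2).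
  by apply: trig_continuousB; apply: trig_continuousB; exact: trig_continuous_coord.
have lt1 := lt_neqAle (circle_cos (phase_difference theta ef.1
  - phase_difference theta ef.2)) 1.
rewrite (ht ef h1 h2) circle_cos_le1 in lt1.
have := @cvgr_lt _ _ _ (nbhs_filter theta) _ _ (hc theta) _ lt1.
by apply: filterS => x hx _ _; rewrite lt_eqF.
Qed.

(** If cos a = 1 then cos (a + u w) = cos (u w), which is less than 1 for small
    u != 0; otherwise continuity at u = 0 suffices. *)
Lemma near_cos_neq1 (a w : R) : w != 0 -> \forall u \near 0^', cos (a + u * w) != 1.
Proof.
move=> w0; have [a1|a1] := eqVneq (cos a) 1.
  have sa : sin a = 0 by apply: cos1sin0; rewrite a1 normr1.
  have r0 : 0 < pi / `|w| by rewrite divr_gt0 ?pi_gt0 ?normr_gt0.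
  near=> u; rewrite cosD a1 sa mul1r mul0r subr0 -cos_norm lt_eqF //.
  have u0 : u != 0 by near: u; exact: nbhs_dnbhs_neq.
  rewrite -[ltRHS]cos0 ltr_cos ?in_itv /= ?lexx ?pi_ge0 ?normr_gt0 ?mulf_neq0 //.
  rewrite normr_ge0 /= normrM -ler_pdivlMr ?normr_gt0 // ltW //.
  by near: u; exact: dnbhs0_lt.
apply: nbhs_dnbhs.
have H : {for (0 : R), continuous (fun u : R => cos (a + u * w))}.
  apply: continuous_comp; last exact: continuous_cos.
  by apply: cvgD; [exact: cvg_cst|apply: cvgM; [exact: cvg_id|exact: cvg_cst]].
have lt1 : cos (a + 0 * w) < 1 by rewrite mul0r addr0 lt_neqAle a1 cos_le1.
have := @cvgr_lt _ _ _ (nbhs_filter (0 : R)) _ _ H _ lt1.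
by apply: filterS => u hu; rewrite lt_eqF.
Unshelve. all: by end_near. Qed.

Lemma continuous_torus_curve (t w : 'I_N -> R) :
  continuous (fun u : R => (fun i => qpi (t i + u * w i)) : torus R N).
Proof.
move=> u; apply/cvg_sup => i A [B] [[W oW <-] /= Wu WA].
have ci : continuous (fun u : R => qpi (t i + u * w i)).
  move=> v; apply: continuous_comp; last exact: pi_continuous.
  by apply: cvgD; [exact: cvg_cst|apply: cvgM; [exact: cvg_id|exact: cvg_cst]].
have cW : \forall v \near u, W (qpi (t i + v * w i)).
  by apply: ci; exact: open_nbhs_nbhs.
by apply: (@filterS _ (nbhs u) (nbhs_filter u) _ _ _ cW) => v Wv; exact: WA.
Qed.

(** Move theta with speeds 2^i.  Then d_(j,k) - d_(l,m) moves with speed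
    2^j - 2^k - 2^l + 2^m, which for j != k vanishes only if
    (j, k) = (l, m). *)
Lemma dense_generic_phases : dense generic_phases.
Proof.
move=> O [theta Otheta] oO.
pose w (i : 'I_N) : R := 2 ^+ i.
pose curve (u : R) : torus R N := fun i => qpi (repr (theta i) + u * w i).
have c0 : curve 0 = theta.
  by apply/funext => i; rewrite /curve mul0r addr0 reprK.
have near_O : \forall u \near 0^', O (curve u).
  apply: nbhs_dnbhs.
  have cc : curve u @[u --> (0 : R)] --> theta.
    by rewrite -c0; exact: continuous_torus_curve.
  by apply: cc; exact: open_nbhs_nbhs.
have near_generic : \forall u \near 0^', generic_phases (curve u).
  apply: (@filter_forall _ _ (fun ef u => separated_pair ef (curve u)) (0 : R)^'
    (Proper_dnbhs_numFieldType (0 : R))).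
  move=> -[[j k] [l m]]; rewrite /separated_pair /=.
  have [jk|_] := boolP (j != k); last by apply: filterE.
  have [jklm|_] := boolP ((j, k) != (l, m)); last by apply: filterE.
  pose a i := repr (theta i).
  have W0 : w j - w k - (w l - w m) != 0.
    rewrite subr_eq0 subr_eq addrAC eq_sym subr_eq /w -!natrX -!natrD eqr_nat.
    apply: contraNneq jklm => /expn2_sidon[[lj km]|[lm kj]].
      by rewrite xpair_eqE -!val_eqE /= lj km !eqxx.
    by case/eqP: jk; apply: val_inj.
  apply: filterS (near_cos_neq1 (a j - a k - (a l - a m)) _ W0) => u hu _ _.
  rewrite /phase_difference /curve /= -!pi_circleB circle_cosE.
  by move: hu; congr (cos _ != 1); rewrite /a; ring.
have [u [Ou gu]] := @filter_ex _ _ (Proper_dnbhs_numFieldType (0 : R)) _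
  (filterI near_O near_generic).
by exists (curve u).
Qed.

(** The loop (i0, i0) stands for the point 0 of the circle, where the additional
    bump is centred. *)
Lemma generic_coupling (theta : torus R N) (i0 : 'I_N)
    (H : {set 'I_N * 'I_N}) : generic_phases theta -> loopless H ->
  exists g : circle R -> R,
    coupling_function g /\ effective_coupling_graph g theta = H.
Proof.
move=> gt lH; pose d := phase_difference theta.
have sep e f : e.1 != e.2 -> e != f -> circle_cos (d e - d f) != 1.
  by move=> e12 ef; exact: (gt (e, f)).
have d_inj e f : e.1 != e.2 -> d e = d f -> e = f.
  move=> e12 def; apply/eqP; apply: contraT => ef.
  by have := sep _ _ e12 ef; rewrite def circle_cos_subr0 eqxx.
pose Q := [seq d e | e <- (i0, i0) :: [seq e <- enum {: 'I_N * 'I_N} | e.1 != e.2]].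
pose s := [seq d e | e <- (i0, i0) :: enum H].
have HN e : e \in H -> e.1 != e.2.
  by case: e => j k; apply: contraTneq => /= ->; exact: lH.
have [||//|g cg gQ] := @coupling_with_dead_points _ Q s.
- move=> _ _ /mapP[e eQ ->] /mapP[f fQ ->] def.
  have ef : e != f by apply: contraNneq def => ->.
  have [e12|e12] := boolP (e.1 != e.2); first exact: sep.
  have [f12|f12] := boolP (f.1 != f.2); first by rewrite circle_cosC sep // eq_sym.
  move: eQ fQ ef; rewrite !inE !mem_filter (negbTE e12) (negbTE f12) !orbF.
  by move=> /eqP -> /eqP ->; rewrite eqxx.
- move=> _ /mapP[e es ->]; apply: map_f; move: es; rewrite !inE mem_enum.
  by case/orP => [->//|eH]; rewrite mem_filter HN // mem_enum orbT.
exists g; split => //; apply/setP => e; rewrite inE.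
have [e12|e12] := boolP (e.1 != e.2); last first.
  by apply/esym; apply: contraNF e12; exact: HN.
have eQ : d e \in Q by apply: map_f; rewrite inE mem_filter e12 mem_enum orbT.
have -> : (e \in H) = (d e \in s).
  apply/idP/mapP => [eH|[f fs /(d_inj _ _ e12) ef]].
    by exists e => //; rewrite inE mem_enum eH orbT.
  move: fs; rewrite -ef inE mem_enum => /orP[/eqP e0|//].
  by move: e12; rewrite e0 eqxx.
rewrite /=; apply/idP/idP => [|es].
  by apply: contraR => /(gQ _ eQ) h; apply/mem_set.
by apply: contraL es => /set_mem /(gQ _ eQ).
Qed.
End generic.

Theorem proposition4 (R : realType) (N : nat) (hN : (2 <= N)%N) :
  exists U : set (torus R N),
    [/\ open U, dense U &
      forall theta : torus R N, U theta ->
      forall H : {set 'I_N * 'I_N}, loopless H ->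
      exists g : circle R -> R,
        coupling_function g /\ effective_coupling_graph g theta = H].
Proof.
exists (generic_phases N); split.
- exact: open_generic_phases.
- exact: dense_generic_phases.
- by move=> theta gt H; exact: generic_coupling _ _ (Ordinal (ltnW hN)) H gt.
Qed.
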